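(* Let $n \geq 3$. Let $F \colon \mathbf{Ring}^{\mathrm{op}} \to \mathbf{Loc}$ be any functor that assigns to each commutative ring its Pierce spectrum, i.e. the restriction of $F$ to $\mathbf{cRing}^{\mathrm{op}}$ is the Pierce spectrum functor $\mathbf{cRing}^{\mathrm{op}} \to \mathbf{Loc}$ (up to natural isomorphism). Then $F$ trivializes on the ring $\mathbb{M}_n(\mathbb{C})$ of $n$-by-$n$ complex matrices: $F(\mathbb{M}_n(\mathbb{C}))$ is an initial object of $\mathbf{Loc}$, that is, isomorphic to the locale of opens of the empty topological space.
   Context: All rings are unital. $\mathbf{Ring}$ is the category of (not necessarily commutative) rings and unital ring homomorphisms, and $\mathbf{cRing}$ is its full subcategory of commutative rings. A locale is a complete lattice $L$ satisfying $\bigvee_i (x \wedge y_i) = x \wedge \bigvee_i y_i$. A morphism of locales $K \to L$ is a function $f \colon L \to K$ preserving finite meets (including the top element) and arbitrary joins. These form the category $\mathbf{Loc}$, whose initial object is the one-element lattice. The Pierce spectrum of a commutative ring $A$ is the Stone space of its Boolean algebra of idempotents $E(A)=\{e \in A \mid e^2 = e\}$ (with $e \land f = ef$, $e \lor f = e+f-ef$, $\lnot e = 1-e$), regarded as a locale: it is the locale $\mathrm{Idl}(E(A))$ of ideals of $E(A)$ ordered by inclusion. A ring homomorphism $A \to B$ restricts to a Boolean homomorphism $g \colon E(A) \to E(B)$, which induces a locale morphism $\mathrm{Idl}(E(B)) \to \mathrm{Idl}(E(A))$, given by the function sending an ideal $I$ of $E(A)$ to the down closure of $g(I)$. *)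

(* Defs.v *)
From HB Require Import structures.
From mathcomp Require Import all_boot all_order all_algebra.
From mathcomp Require Import complex ring.
From mathcomp Require Import boolp classical_sets reals topology.

Set Implicit Arguments.
Unset Strict Implicit.
Unset Printing Implicit Defensive.

Import Order.Theory GRing.Theory.

Local Open Scope classical_set_scope.
Local Open Scope order_scope.

Record category := Category {
  obj :> Type;
  hom : obj -> obj -> Type;
  idm : forall a, hom a a;
  comp : forall a b c, hom b c -> hom a b -> hom a c;
  comp_idl : forall a b (f : hom a b), comp (idm b) f = f;
  comp_idr : forall a b (f : hom a b), comp f (idm a) = f;
  comp_assoc : forall a b c d (h : hom c d) (g : hom b c) (f : hom a b),
    comp h (comp g f) = comp (comp h g) f }.

Arguments idm {c0} a : rename.
Arguments comp {c0} [a b c] : rename.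

Definition op (C : category) : category :=
  @Category C (fun a b => hom b a) (fun a => idm a)
    (fun a b c g f => comp f g)
    (fun a b f => comp_idr f) (fun a b f => comp_idl f)
    (fun a b c d h g f => esym (comp_assoc f g h)).

Record functor (C D : category) := Functor {
  fobj :> C -> D;
  fmap : forall a b, hom a b -> hom (fobj a) (fobj b);
  fmap_id : forall a, fmap (idm a) = idm (fobj a);
  fmap_comp : forall a b c (g : hom b c) (f : hom a b),
    fmap (comp g f) = comp (fmap g) (fmap f) }.

Arguments fmap {C D} f0 [a b] : rename.

Definition op_functor (C D : category) (F : functor C D) :
    functor (op C) (op D) :=
  @Functor (op C) (op D) F (fun a b f => fmap F f)
    (fun a => fmap_id F a) (fun a b c g f => fmap_comp F f g).

Lemma comp_functor_id (C D E : category) (G : functor D E) (F : functor C D)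
  (a : C) : fmap G (fmap F (idm a)) = idm (G (F a)).
Proof. by rewrite !fmap_id. Qed.

Lemma comp_functor_comp (C D E : category) (G : functor D E) (F : functor C D)
  (a b c : C) (g : hom b c) (f : hom a b) :
  fmap G (fmap F (comp g f)) = comp (fmap G (fmap F g)) (fmap G (fmap F f)).
Proof. by rewrite !fmap_comp. Qed.

Definition comp_functor (C D E : category) (G : functor D E) (F : functor C D) :
    functor C E :=
  @Functor C E (fun a => G (F a)) (fun a b f => fmap G (fmap F f))
    (comp_functor_id G F) (comp_functor_comp G F).

Definition is_iso (C : category) (a b : C) (f : hom a b) : Prop :=
  exists g : hom b a, comp g f = idm a /\ comp f g = idm b.

Definition isomorphic (C : category) (a b : C) : Prop :=
  exists f : hom a b, is_iso f.

Definition nat_isomorphic (C D : category) (F G : functor C D) : Prop :=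
  exists theta : forall a, hom (F a) (G a),
    (forall a, is_iso (theta a)) /\
    (forall a b (f : hom a b),
       comp (theta b) (fmap F f) = comp (fmap G f) (theta a)).

Definition is_initial (C : category) (a : C) : Prop :=
  forall b : C, exists! f : hom a b, True.

(* The structures with prefix pz, unlike those with prefix nz, include the
   zero ring. *)

Lemma rmorphism_ext (R S : pzRingType) (f g : {rmorphism R -> S}) :
  f =1 g -> f = g.
Proof.
case: f g => [f [a b]] [g [a' b']] /= /funext fg.
case: _ / fg a' b' => a' b'.
have -> : a = a'.
  case: a a' => [p] [p']; congr Algebra.isNmodMorphism.Axioms_.
  exact: Prop_irrelevance.
have -> // : b = b'.
case: b b' => [p] [p']; congr GRing.isMonoidMorphism.Axioms_.
exact: Prop_irrelevance.
Qed.

Definition rcomp (R S T : pzRingType) (g : {rmorphism S -> T})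
  (f : {rmorphism R -> S}) : {rmorphism R -> T} := g \o f.

Definition Ring : category :=
  @Category pzRingType (fun R S => {rmorphism R -> S})
    (fun R => idfun) rcomp
    (fun R S f => @rmorphism_ext R S (rcomp idfun f) f (fun=> erefl))
    (fun R S f => @rmorphism_ext R S (rcomp f idfun) f (fun=> erefl))
    (fun R S T U h g f => @rmorphism_ext R U
       (rcomp h (rcomp g f)) (rcomp (rcomp h g) f) (fun=> erefl)).

Definition cRing : category :=
  @Category comPzRingType (fun A B => {rmorphism A -> B})
    (fun A => idfun) (fun A B C => @rcomp A B C)
    (fun A B f => @comp_idl Ring A B f)
    (fun A B f => @comp_idr Ring A B f)
    (fun A B C D h g f => @comp_assoc Ring A B C D h g f).

Definition cRing_incl : functor cRing Ring :=
  @Functor cRing Ring (fun A : comPzRingType => (A : pzRingType))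
    (fun A B f => f) (fun A => erefl) (fun A B C g f => erefl).

(* All locales share one display, which carries no information. *)

Fact locale_display : Order.disp_t. Proof. exact: Order.Disp tt tt. Qed.

HB.mixin Record TBLattice_isFrame d T of Order.TBLattice d T := {
  bigsup : set T -> T;
  bigsup_ub : forall (S : set T) x, S x -> x <= bigsup S;
  bigsup_le : forall (S : set T) y, (forall x, S x -> x <= y) -> bigsup S <= y;
  meet_bigsup : forall x (S : set T),
    x `&` bigsup S = bigsup [set x `&` y | y in S] }.

#[short(type="frameType")]
HB.structure Definition Frame d :=
  { T of Order.TBLattice d T & TBLattice_isFrame d T }.

Notation locale := (frameType locale_display).

Record frame_hom (L K : locale) := FrameHom {
  frame_fun :> L -> K;
  frame_hom_top : frame_fun \top = \top;
  frame_hom_meet : forall x y, frame_fun (x `&` y) = frame_fun x `&` frame_fun y;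
  frame_hom_bigsup : forall S, frame_fun (bigsup S) = bigsup (frame_fun @` S) }.

Lemma frame_hom_ext (L K : locale) (f g : frame_hom L K) : f =1 g -> f = g.
Proof.
case: f g => [f a b c] [g a' b' c'] /= /funext fg.
case: _ / fg a' b' c' => a' b' c'.
by congr FrameHom; apply: Prop_irrelevance.
Qed.

Definition frame_idm (L : locale) : frame_hom L L :=
  @FrameHom L L idfun erefl (fun x y => erefl)
    (fun S => congr1 bigsup (esym (image_id S))).

Section FrameComp.
Variables (L K M : locale) (g : frame_hom K M) (f : frame_hom L K).

Fact frame_comp_top : g (f \top) = \top.
Proof. by rewrite !frame_hom_top. Qed.

Fact frame_comp_meet x y : g (f (x `&` y)) = g (f x) `&` g (f y).
Proof. by rewrite !frame_hom_meet. Qed.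

Fact frame_comp_bigsup S :
  g (f (bigsup S)) = bigsup ((fun x => g (f x)) @` S).
Proof. by rewrite !frame_hom_bigsup image_comp. Qed.

Definition frame_comp : frame_hom L M :=
  FrameHom frame_comp_top frame_comp_meet frame_comp_bigsup.

End FrameComp.

(* A morphism of locales K -> L is a frame homomorphism L -> K. *)
Definition Loc : category :=
  @Category locale (fun K L => frame_hom L K) frame_idm
    (fun K L M g f => frame_comp f g)
    (fun K L f => @frame_hom_ext L K (frame_comp f (frame_idm L)) f
       (fun=> erefl))
    (fun K L f => @frame_hom_ext L K (frame_comp (frame_idm K) f) f
       (fun=> erefl))
    (fun K L M N h g f => @frame_hom_ext N K
       (frame_comp (frame_comp f g) h) (frame_comp f (frame_comp g h))
       (fun=> erefl)).

Section Opens.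
Variable T : topologicalType.

Record opens := Opens { opens_set :> set T; _ : open opens_set }.

Lemma opensP (U : opens) : open U. Proof. by case: U. Qed.

Lemma opens_inj (U V : opens) : U = V :> set T -> U = V.
Proof.
case: U V => [U oU] [V oV] /= UV.
by case: _ / UV oV => oV; congr Opens; apply: Prop_irrelevance.
Qed.

HB.instance Definition _ := gen_eqMixin opens.
HB.instance Definition _ := gen_choiceMixin opens.

Let le (U V : opens) := `[< opens_set U `<=` opens_set V >].

Fact opens_le_refl : reflexive le.
Proof. by move=> U; apply/asboolP. Qed.

Fact opens_le_anti : antisymmetric le.
Proof.
by move=> U V /andP[/asboolP UV /asboolP VU]; apply/opens_inj/seteqP.
Qed.

Fact opens_le_trans : transitive le.
Proof.
by move=> V U W /asboolP UV /asboolP VW; apply/asboolP/(subset_trans UV).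
Qed.

HB.instance Definition _ := Order.Le_isPOrder.Build locale_display opens
  opens_le_refl opens_le_anti opens_le_trans.

Let meet (U V : opens) := Opens (openI (opensP U) (opensP V)).
Let join (U V : opens) := Opens (openU (opensP U) (opensP V)).

Fact opens_meetP U V W : (U <= meet V W) = (U <= V) && (U <= W).
Proof.
apply/asboolP/andP => [UVW|[/asboolP UV /asboolP UW]].
  by split; apply/asboolP => x /UVW[].
by move=> x Ux; split; [exact: UV|exact: UW].
Qed.

Fact opens_joinP U V W : (join U V <= W) = (U <= W) && (V <= W).
Proof.
apply/asboolP/andP => [UVW|[/asboolP UW /asboolP VW]].
  by split; apply/asboolP => x ?; apply: UVW; [left|right].
by move=> x [/UW|/VW].
Qed.

HB.instance Definition _ :=
  Order.POrder_MeetJoin_isLattice.Build locale_display opens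
    opens_meetP opens_joinP.

Fact opens_le0 (U : opens) : Opens open0 <= U.
Proof. by apply/asboolP. Qed.

Fact opens_leT (U : opens) : U <= Opens openT.
Proof. by apply/asboolP. Qed.

HB.instance Definition _ :=
  Order.hasBottom.Build locale_display opens opens_le0.
HB.instance Definition _ := Order.hasTop.Build locale_display opens opens_leT.

Let sup (S : set opens) :=
  Opens (@bigcup_open T opens S opens_set (fun U _ => opensP U)).

Fact opens_sup_ub (S : set opens) U : S U -> U <= sup S.
Proof. by move=> SU; apply/asboolP => x Ux; exists U. Qed.

Fact opens_sup_le (S : set opens) V : (forall U, S U -> U <= V) -> sup S <= V.
Proof. by move=> SV; apply/asboolP => x [U /SV/asboolP]; apply. Qed.

Fact opens_meet_sup (U : opens) S :
  U `&` sup S = sup [set U `&` V | V in S].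
Proof.
apply/opens_inj/seteqP; split=> x.
  by move=> [Ux [V SV Vx]]; exists (U `&` V) => //; exists V.
by move=> [_ [V SV <-]] [Ux Vx]; split=> //; exists V.
Qed.

HB.instance Definition _ := TBLattice_isFrame.Build locale_display opens
  opens_sup_ub opens_sup_le opens_meet_sup.

End Opens.

(* The library's {tblmorphism _ -> _} does not require compatibility with meets
   and joins. *)
Record bool_hom d (B : ctbDistrLatticeType d) d' (B' : ctbDistrLatticeType d') :=
  BoolHom {
    bool_fun :> B -> B';
    bool_hom_bot : bool_fun \bot = \bot;
    bool_hom_top : bool_fun \top = \top;
    bool_hom_meet : forall x y, bool_fun (x `&` y) = bool_fun x `&` bool_fun y;
    bool_hom_join : forall x y, bool_fun (x `|` y) = bool_fun x `|` bool_fun y;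
    bool_hom_compl : forall x, bool_fun (~` x) = ~` bool_fun x }.

Fact idempotents_display : Order.disp_t. Proof. exact: Order.Disp tt tt. Qed.

Section Idempotents.
Variable A : comPzRingType.
Local Open Scope ring_scope.

Record idempotents := Idempotent {
  idem_val : A;
  _ : idem_val ^+ 2 == idem_val }.

HB.instance Definition _ := [isSub for idem_val].
HB.instance Definition _ := [Choice of idempotents by <:].

Implicit Types e f g : idempotents.

Lemma idemM e : val e * val e = val e.
Proof. by case: e => x /= /eqP; rewrite expr2. Qed.

Fact idem_meet_subproof e f : (val e * val f) ^+ 2 == val e * val f.
Proof. by rewrite exprMn !expr2 !idemM. Qed.

Fact idem_compl_subproof e : (1 - val e) ^+ 2 == 1 - val e.
Proof. by rewrite expr2 mulrBl mul1r mulrBr mulr1 idemM subrr subr0. Qed.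

Fact idem_join_subproof e f :
  (val e + val f - val e * val f) ^+ 2 == val e + val f - val e * val f.
Proof.
have -> : val e + val f - val e * val f = 1 - (1 - val e) * (1 - val f) by ring.
have /eqP ce := idem_compl_subproof e; have /eqP cf := idem_compl_subproof f.
have cef : ((1 - val e) * (1 - val f)) ^+ 2 == (1 - val e) * (1 - val f).
  by rewrite exprMn ce cf.
exact: (idem_compl_subproof (Idempotent cef)).
Qed.

Fact idem0_subproof : (0 : A) ^+ 2 == 0. Proof. by rewrite expr0n. Qed.
Fact idem1_subproof : (1 : A) ^+ 2 == 1. Proof. by rewrite expr1n. Qed.

Definition idem_meet e f := Idempotent (idem_meet_subproof e f).
Definition idem_join e f := Idempotent (idem_join_subproof e f).
Definition idem_compl e := Idempotent (idem_compl_subproof e).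
Definition idem0 := Idempotent idem0_subproof.
Definition idem1 := Idempotent idem1_subproof.
Definition idem_le e f := idem_meet e f == e.
Definition idem_lt e f := (f != e) && idem_le e f.

Fact idem_meetC : commutative idem_meet.
Proof. by move=> e f; apply/val_inj; rewrite /= mulrC. Qed.

Fact idem_joinC : commutative idem_join.
Proof. by move=> e f; apply/val_inj => /=; ring. Qed.

Fact idem_meetA : associative idem_meet.
Proof. by move=> e f g; apply/val_inj; rewrite /= mulrA. Qed.

Fact idem_joinA : associative idem_join.
Proof. by move=> e f g; apply/val_inj => /=; ring. Qed.

Fact idem_joinKI f e : idem_meet e (idem_join e f) = e.
Proof.
by apply/val_inj; rewrite /= mulrBr mulrDr mulrA idemM addrK.
Qed.

Fact idem_meetKU f e : idem_join e (idem_meet e f) = e.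
Proof. by apply/val_inj; rewrite /= mulrA idemM addrK. Qed.

Fact idem_meetUl : left_distributive idem_meet idem_join.
Proof.
by move=> e f g; apply/val_inj; rewrite /= [X in _ = _ - X]mulrACA idemM -mulrDl -mulrBl.
Qed.

Fact idem_meetxx : idempotent_op idem_meet.
Proof. by move=> e; apply/val_inj/idemM. Qed.

HB.instance Definition _ :=
  Order.isMeetJoinDistrLattice.Build idempotents_display idempotents
    (fun e f => erefl (idem_le e f)) (fun e f => erefl (idem_lt e f))
    idem_meetC idem_joinC idem_meetA idem_joinA
    idem_joinKI idem_meetKU idem_meetUl idem_meetxx.

Fact idem_le0 e : (idem0 <= e)%O.
Proof. by apply/eqP/val_inj; rewrite /= mul0r. Qed.

Fact idem_le1 e : (e <= idem1)%O.
Proof. by apply/eqP/val_inj; rewrite /= mulr1. Qed.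

HB.instance Definition _ :=
  Order.hasBottom.Build idempotents_display idempotents idem_le0.
HB.instance Definition _ :=
  Order.hasTop.Build idempotents_display idempotents idem_le1.

Fact idem_joinxC e : (e `|` idem_compl e)%O = \top%O.
Proof. by apply/val_inj; rewrite /= mulrBr mulr1 idemM subrr subr0 addrC subrK. Qed.

Fact idem_meetxC e : (e `&` idem_compl e)%O = \bot%O.
Proof. by apply/val_inj; rewrite /= mulrBr mulr1 idemM subrr. Qed.

HB.instance Definition _ :=
  Order.TBDistrLattice_hasComplement.Build idempotents_display idempotents
    idem_joinxC idem_meetxC.

End Idempotents.

Section IdempotentsMap.
Variables (A B : comPzRingType) (h : {rmorphism A -> B}).
Implicit Types e f : idempotents A.

Fact idem_map_subproof e : (h (val e) ^+ 2 == h (val e))%R.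
Proof. by rewrite -rmorphXn expr2 idemM. Qed.

Definition idem_map e : idempotents B := Idempotent (idem_map_subproof e).

Fact idem_map_bot : idem_map \bot = \bot.
Proof. by apply/val_inj; rewrite /= rmorph0. Qed.

Fact idem_map_top : idem_map \top = \top.
Proof. by apply/val_inj; rewrite /= rmorph1. Qed.

Fact idem_map_meet e f : idem_map (e `&` f) = idem_map e `&` idem_map f.
Proof. by apply/val_inj; rewrite /= rmorphM. Qed.

Fact idem_map_join e f : idem_map (e `|` f) = idem_map e `|` idem_map f.
Proof. by apply/val_inj; rewrite /= rmorphB rmorphD rmorphM. Qed.

Fact idem_map_compl e : idem_map (~` e) = ~` idem_map e.
Proof. by apply/val_inj; rewrite /= rmorphB rmorph1. Qed.

Definition idempotents_map : bool_hom (idempotents A) (idempotents B) :=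
  BoolHom idem_map_bot idem_map_top idem_map_meet idem_map_join idem_map_compl.

End IdempotentsMap.

Section Ideals.
Variables (d : Order.disp_t) (B : ctbDistrLatticeType d).

Record ideal := Ideal {
  ideal_set :> B -> Prop;
  ideal_bot : ideal_set \bot;
  ideal_join : forall x y, ideal_set x -> ideal_set y -> ideal_set (x `|` y);
  ideal_down : forall x y, x <= y -> ideal_set y -> ideal_set x }.

Lemma ideal_inj (I J : ideal) : ideal_set I = ideal_set J -> I = J.
Proof.
case: I J => [I a b c] [J a' b' c'] /= IJ.
case: _ / IJ a' b' c' => a' b' c'.
by congr Ideal; apply: Prop_irrelevance.
Qed.

HB.instance Definition _ := gen_eqMixin ideal.
HB.instance Definition _ := gen_choiceMixin ideal.

Implicit Types I J K : ideal.

Let le I J := `[< ideal_set I `<=` ideal_set J >].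

Fact ideal_le_refl : reflexive le.
Proof. by move=> I; apply/asboolP. Qed.

Fact ideal_le_anti : antisymmetric le.
Proof.
by move=> I J /andP[/asboolP IJ /asboolP JI]; apply/ideal_inj/seteqP.
Qed.

Fact ideal_le_trans : transitive le.
Proof.
by move=> J I K /asboolP IJ /asboolP JK; apply/asboolP/(subset_trans IJ).
Qed.

HB.instance Definition _ := Order.Le_isPOrder.Build locale_display ideal
  ideal_le_refl ideal_le_anti ideal_le_trans.

Lemma ideal_leP I J : reflect (ideal_set I `<=` ideal_set J) (I <= J).
Proof. exact: asboolP. Qed.

Definition ideal_meet I J : ideal.
Proof.
exists (ideal_set I `&` ideal_set J)%classic.
- by split; exact: ideal_bot.
- by move=> x y [Ix Jx] [Iy Jy]; split; exact: ideal_join.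
- by move=> x y xy [Iy Jy]; split; exact: ideal_down xy _.
Defined.

(* The ideal generated by the union of a family of ideals. *)
Definition ideal_sup (S : set ideal) : ideal.
Proof.
exists [set x | exists2 s : seq B,
  (forall y, y \in s -> exists2 I, S I & I y) & x <= \join_(y <- s) y].
- by exists [::] => //; rewrite big_nil.
- move=> x y [s sS xs] [t tS yt]; exists (s ++ t).
    by move=> z; rewrite mem_cat => /orP[/sS|/tS].
  by rewrite big_cat /= leU2.
- by move=> x y xy [s sS ys]; exists s => //; exact: le_trans ys.
Defined.

Fact ideal_sup_ub (S : set ideal) I : S I -> I <= ideal_sup S.
Proof.
move=> SI; apply/ideal_leP => x Ix; exists [:: x]; last by rewrite big_seq1.
by move=> y; rewrite inE => /eqP ->; exists I.
Qed.

Lemma ideal_bigjoin I (s : seq B) :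
  (forall y, y \in s -> I y) -> I (\join_(y <- s) y).
Proof.
move=> sI; rewrite big_seq; apply: (big_ind (ideal_set I)) => //.
- exact: ideal_bot.
- exact: ideal_join.
Qed.

Fact ideal_sup_le (S : set ideal) J :
  (forall I, S I -> I <= J) -> ideal_sup S <= J.
Proof.
move=> SJ; apply/ideal_leP => x [s sS xs]; apply: (ideal_down xs).
by apply: ideal_bigjoin => y /sS[I /SJ/ideal_leP]; apply.
Qed.

Fact ideal_meetP I J K : (I <= ideal_meet J K) = (I <= J) && (I <= K).
Proof.
apply/ideal_leP/andP => [IJK|[/ideal_leP IJ /ideal_leP IK]].
  by split; apply/ideal_leP => x /IJK[].
by move=> x Ix; split; [exact: IJ|exact: IK].
Qed.

Fact ideal_joinP I J K :
  (ideal_sup [set I; J] <= K) = (I <= K) && (J <= K).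
Proof.
apply/idP/andP => [IJK|[IK JK]].
  by split; apply: le_trans IJK; apply: ideal_sup_ub; [left|right].
by apply: ideal_sup_le => _ [->|->].
Qed.

HB.instance Definition _ :=
  Order.POrder_MeetJoin_isLattice.Build locale_display ideal
    ideal_meetP ideal_joinP.

Definition ideal0 : ideal.
Proof.
exists [set \bot] => //=.
- by move=> x y -> ->; rewrite joinxx.
- by move=> x y + yb; rewrite yb lex0 => /eqP.
Defined.

Definition ideal1 : ideal.
Proof. by exists setT. Defined.

Fact ideal_le0 I : ideal0 <= I.
Proof. by apply/ideal_leP => _ ->; exact: ideal_bot. Qed.

Fact ideal_le1 I : I <= ideal1.
Proof. by apply/ideal_leP. Qed.

HB.instance Definition _ :=
  Order.hasBottom.Build locale_display ideal ideal_le0.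
HB.instance Definition _ := Order.hasTop.Build locale_display ideal ideal_le1.

Fact ideal_meet_sup I (S : set ideal) :
  I `&` ideal_sup S = ideal_sup [set I `&` J | J in S].
Proof.
apply/eqP; rewrite eq_le; apply/andP; split; last first.
  apply: ideal_sup_le => _ [J SJ <-]; apply: leI2 => //; exact: ideal_sup_ub.
apply/ideal_leP => x [Ix [s sS xs]]; exists [seq x `&` y | y <- s].
  move=> _ /mapP[y /sS[J SJ Jy] ->]; exists (I `&` J); first by exists J.
  by split; [exact: (ideal_down (leIl x y))|exact: (ideal_down (leIr y x))].
suff -> : \join_(z <- [seq x `&` y | y <- s]) z = x `&` \join_(y <- s) y.
  by rewrite lexI lexx.
rewrite big_map; elim: s {sS xs} => [|y s IHs].
  by rewrite !big_nil meetx0.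
by rewrite !big_cons meetUr IHs.
Qed.

HB.instance Definition _ := TBLattice_isFrame.Build locale_display ideal
  ideal_sup_ub ideal_sup_le ideal_meet_sup.

End Ideals.

Section IdealMap.
Variables (d : Order.disp_t) (B : ctbDistrLatticeType d).
Variables (d' : Order.disp_t) (B' : ctbDistrLatticeType d').
Variable g : bool_hom B B'.

Lemma bool_hom_le x y : x <= y -> g x <= g y.
Proof. by move=> /meet_idPl xy; apply/meet_idPl; rewrite -bool_hom_meet xy. Qed.

Definition ideal_image (I : ideal B) : ideal B'.
Proof.
exists [set y | exists2 x, I x & y <= g x].
- by exists \bot; [exact: ideal_bot|rewrite le0x].
- move=> x y [a Ia xa] [b Ib yb]; exists (a `|` b); first exact: ideal_join.
  by rewrite bool_hom_join leU2.
- by move=> x y xy [a Ia ya]; exists a => //; exact: le_trans ya.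
Defined.

Fact ideal_image_top : ideal_image \top = \top.
Proof.
apply/ideal_inj/seteqP; split=> // x _; exists \top => //.
by rewrite bool_hom_top lex1.
Qed.

Fact ideal_image_meet I J :
  ideal_image (I `&` J) = ideal_image I `&` ideal_image J.
Proof.
apply/ideal_inj/seteqP; split=> y.
  by move=> [x [Ix Jx] yx]; split; exists x.
move=> [[a Ia ya] [b Jb yb]]; exists (a `&` b).
  by split; [exact: (ideal_down (leIl a b))|exact: (ideal_down (leIr b a))].
by rewrite bool_hom_meet lexI ya.
Qed.

Fact ideal_image_bigsup S :
  ideal_image (bigsup S) = bigsup (ideal_image @` S).
Proof.
apply/ideal_inj/seteqP; split=> y; last first.
  move: y; apply/ideal_leP/bigsup_le => _ [I SI <-].
  apply/ideal_leP => y [x Ix yx]; exists x => //.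
  by apply: (ideal_leP _ _ _) Ix; exact: bigsup_ub.
move=> [x [s sS xs] yx]; exists [seq g z | z <- s].
  move=> _ /mapP[z /sS[I SI Iz] ->]; exists (ideal_image I); first by exists I.
  by exists z.
apply: (le_trans yx); apply: (le_trans (bool_hom_le xs)).
rewrite big_map; elim: s {sS xs} => [|z s IHs].
  by rewrite !big_nil bool_hom_bot.
by rewrite !big_cons bool_hom_join leU2.
Qed.

Definition ideal_map : frame_hom (ideal B) (ideal B') :=
  FrameHom ideal_image_top ideal_image_meet ideal_image_bigsup.

End IdealMap.

Definition pierce_obj (A : comPzRingType) : locale := ideal (idempotents A).

Definition pierce_map (A B : comPzRingType) (h : {rmorphism A -> B}) :
    frame_hom (pierce_obj A) (pierce_obj B) :=
  ideal_map (idempotents_map h).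

Lemma pierce_map_id (A : comPzRingType) :
  pierce_map (idfun : {rmorphism A -> A}) = frame_idm (pierce_obj A).
Proof.
apply: frame_hom_ext => I; apply/ideal_inj/seteqP; split=> e.
  move=> [f If ef]; apply: ideal_down If.
  by suff <- : idem_map idfun f = f by []; exact: val_inj.
by move=> Ie; exists e => //; apply/eqP/val_inj; rewrite /= idemM.
Qed.

Lemma pierce_map_comp (A B C : comPzRingType)
  (h : {rmorphism B -> C}) (k : {rmorphism A -> B}) :
  pierce_map (rcomp h k) = frame_comp (pierce_map h) (pierce_map k).
Proof.
apply: frame_hom_ext => I; apply/ideal_inj/seteqP; split=> e.
  move=> [f If ef]; exists (idem_map k f); first by exists f.
  by apply: (le_trans ef); rewrite le_eqVlt; apply/orP/or_introl/eqP/val_inj.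
move=> [f [f' If' ff'] ef]; exists f' => //; apply: (le_trans ef).
apply: (le_trans (bool_hom_le (idempotents_map h) ff')).
by rewrite le_eqVlt; apply/orP/or_introl/eqP/val_inj.
Qed.

Definition Pierce : functor (op cRing) Loc :=
  @Functor (op cRing) Loc pierce_obj (fun A B h => pierce_map h)
    pierce_map_id (fun A B C h k => pierce_map_comp k h).

Definition empty_space : topologicalType := discrete_topology void.

(* Main.v *)
Require Import Defs.
From HB Require Import structures.
From mathcomp Require Import all_boot all_order all_algebra.
From mathcomp Require Import complex reals.
From mathcomp Require Import ring boolp classical_sets.

Set Implicit Arguments.
Unset Strict Implicit.
Unset Printing Implicit Defensive.

Import Order.Theory GRing.Theory.

(** A clopen of the Pierce spectrum of a commutative ring is an idempotent.
Whatever F is, an idempotent p of a ring S therefore determines an element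
[idem_open p] of the locale F(S): an orthogonal pair p, q of idempotents is
the same thing as a ring homomorphism Z^3 -> S, and F carries the three
clopens of the spectrum of Z^3 to F(S). If p is the image of an idempotent e
of a commutative ring A under a homomorphism A -> S, then the homomorphism Z^3
-> S of p factors through that of e; so, F being a functor, the clopen e of
the spectrum of A gives the same element of F(S) ([idem_open_rmorphism]). As
frame homomorphisms preserve finite meets and joins, the assignment v is
additive on orthogonal pairs: v p and v q are disjoint and v (p + q) is their
join; moreover v 1 is the top element ([idem_open_orthoadditive],
[idem_open1]).

The other half is a Kochen-Specker theorem in the internal logic of the
locale: on n-by-n matrices with n >= 3, every orthogonally additive v has v 1
= bottom ([orthoadditive_bot]). All idempotents are available here, not only
the self-adjoint ones, and this makes the argument short. Write (a, L) for the
rank-one idempotent with image the point a of the projective plane and kernel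
the line L, where a is off L. The three vertices of a triangle with their
opposite sides sum to the identity, so for n = 3, to which the argument
reduces, v says that exactly one of them is true; and (a, L), (b, M) exclude
each other when b is on L and a is on M.

The first step is that b being on L alone suffices for exclusion
([sheared_meet], where a scaling of the vectors makes the matrices integral).
Granting this, if (a, L) is true then so is (b, L) for other points b off L,
because in suitable triangles with vertex b and side L the other two vertices
are excluded ([point_shift]); truth depends on the line only. Finally a line M
through a vertex of a triangle, other than its sides, is incompatible with
each of the three sides, although one of these must be true; so M is false
([sheared_bot]). Every line can take the role of M, hence each rank-one
idempotent is false and so is their sum, the identity.

So bottom = top in F(M_n(C)). A locale with bottom = top has a single element,
which makes it initial, and the opens of the empty space form such a locale.
*)

Local Open Scope ring_scope.
Local Open Scope order_scope.

(** * Binary joins in locales *)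

Lemma bigsup_set2 (L : locale) (x y : L) : bigsup [set x; y]%classic = x `|` y.
Proof.
apply/eqP; rewrite eq_le leUx; apply/and3P; split.
- by apply: bigsup_le => _ [->|->]; [exact: leUl|exact: leUr].
- by apply: bigsup_ub; left.
- by apply: bigsup_ub; right.
Qed.

Lemma frame_meetUr (L : locale) (x y z : L) :
  x `&` (y `|` z) = (x `&` y) `|` (x `&` z).
Proof.
by rewrite -bigsup_set2 meet_bigsup image_setU !image_set1 bigsup_set2.
Qed.

Section FrameHom.
Variables (L K : locale) (h : frame_hom L K).

Lemma frame_hom_join x y : h (x `|` y) = h x `|` h y.
Proof.
by rewrite -bigsup_set2 frame_hom_bigsup image_setU !image_set1 bigsup_set2.
Qed.

Lemma frame_hom_bot : h \bot = \bot.
Proof.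
have bigsup0 (M : locale) : bigsup (@set0 M) = \bot.
  by apply/eqP; rewrite -lex0; apply: bigsup_le.
by rewrite -bigsup0 frame_hom_bigsup image_set0 bigsup0.
Qed.

End FrameHom.

(** * Clopens of the Pierce spectrum *)

Section Principal.
Variables (d : Order.disp_t) (B : ctbDistrLatticeType d).
Implicit Types a b : B.

Definition principal a : ideal B.
Proof.
exists (fun x => x <= a).
- exact: le0x.
- by move=> x y xa ya; rewrite leUx xa.
- by move=> x y xy; apply: le_trans.
Defined.

Lemma principal_meet a b : principal (a `&` b) = principal a `&` principal b.
Proof.
apply/ideal_inj/seteqP; split=> x /=; first by rewrite lexI => /andP[].
by move=> [/= xa xb]; rewrite lexI xa.
Qed.

Lemma principal_le (I : ideal B) a : (principal a <= I) <-> I a.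
Proof.
split=> [/ideal_leP|Ia]; first by apply; exact: lexx.
by apply/ideal_leP => x xa; exact: ideal_down xa Ia.
Qed.

Lemma principal_join a b : principal (a `|` b) = principal a `|` principal b.
Proof.
apply/eqP; rewrite eq_le leUx; apply/and3P; split; apply/principal_le.
- by apply: ideal_join; apply/principal_le; [exact: leUl|exact: leUr].
- exact: leUl.
- exact: leUr.
Qed.

Lemma principal_bot : principal \bot = \bot.
Proof. by apply/eqP; rewrite -lex0; apply/principal_le; exact: ideal_bot. Qed.

Lemma principal_top : principal \top = \top.
Proof. by apply/eqP; rewrite -le1x; apply/ideal_leP => x _; exact: lex1. Qed.

End Principal.

Lemma pierce_map_principal (A B : comPzRingType) (h : {rmorphism A -> B})
  (e : idempotents A) : pierce_map h (principal e) = principal (idem_map h e).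
Proof.
apply/ideal_inj/seteqP; split=> x /=.
  by move=> [a ae xa]; apply: le_trans xa (bool_hom_le (idempotents_map h) ae).
by move=> xe; exists e => //; exact: lexx.
Qed.

(** * Orthogonal idempotents as homomorphisms from Z^3 *)

Definition orthoidem (S : pzRingType) (p q : S) : Prop :=
  [/\ p * p = p, q * q = q, p * q = 0 & q * p = 0].

Definition orthoadditive (S : pzRingType) (L : locale) (v : S -> L) : Prop :=
  forall p q, orthoidem p q -> v p `&` v q = \bot /\ v (p + q) = v p `|` v q.

Section OrthoIdem.
Variable S : pzRingType.
Implicit Types p q : S.

Lemma orthoidem_compl p : p * p = p -> orthoidem p (1 - p).
Proof.
move=> pp; split=> //.
- by rewrite mulrBr mulr1 mulrBl mul1r pp subrr subr0.
- by rewrite mulrBr mulr1 pp subrr.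
- by rewrite mulrBl mul1r pp subrr.
Qed.

Variables (p q : S) (pq : orthoidem p q).

(** The homomorphism from Z^3 that sends the three atoms to p, q and 1 - p - q. *)
Definition split_map (z : int * int * int) : S :=
  p *~ z.1.1 + q *~ z.1.2 + (1 - p - q) *~ z.2.

Lemma split_map_is_zmod_morphism : zmod_morphism split_map.
Proof.
move=> x y; rewrite /split_map /= !mulrzBr !opprD.
by rewrite [RHS]addrACA; congr (_ + _); rewrite addrACA.
Qed.

Lemma split_map_is_monoid_morphism : monoid_morphism split_map.
Proof.
have [pp qq pq0 qp0] := pq.
split.
  by rewrite /split_map /= !mulr1z addrC -[1 - p - q]addrA -opprD subrK.
move=> x y; rewrite /split_map /=.
set r := 1 - p - q.
have pr : p * r = 0 by rewrite /r !mulrBr mulr1 pp pq0 subr0 subrr.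
have qr : q * r = 0 by rewrite /r !mulrBr mulr1 qq qp0 subr0 subrr.
have rp : r * p = 0 by rewrite /r !mulrBl mul1r pp qp0 subr0 subrr.
have rq : r * q = 0 by rewrite /r !mulrBl mul1r qq pq0 subr0 subrr.
have rr : r * r = r by rewrite {2}/r !mulrBr mulr1 rp rq !subr0.
clearbody r.
rewrite !(mulrDl, mulrDr, mulrzAl, mulrzAr) pp qq pq0 qp0 pr qr rp rq rr.
by rewrite !mul0rz !addr0 !add0r -!mulrzA ![y.1.1 * _]mulrC
   ![y.1.2 * _]mulrC ![y.2 * _]mulrC.
Qed.

HB.instance Definition _ := GRing.isZmodMorphism.Build _ _ split_map
  split_map_is_zmod_morphism.
HB.instance Definition _ := GRing.isMonoidMorphism.Build _ _ split_map
  split_map_is_monoid_morphism.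

Definition split_hom : {rmorphism (int * int * int)%type -> S} := split_map.
End OrthoIdem.

Lemma comp_split_hom (A S : pzRingType) (h : {rmorphism A -> S}) (p q : A)
    (pq : orthoidem p q) (hpq : orthoidem (h p) (h q)) :
  rcomp h (split_hom pq) = split_hom hpq.
Proof.
apply: rmorphism_ext => z; rewrite /= /split_map !raddfD /=.
by rewrite !raddfMz !raddfB /= rmorph1.
Qed.

Lemma idem_fst_subproof : ((1, 0, 0) : int * int * int) ^+ 2 == (1, 0, 0).
Proof. by []. Qed.
Lemma idem_snd_subproof : ((0, 1, 0) : int * int * int) ^+ 2 == (0, 1, 0).
Proof. by []. Qed.

Definition idem_fst := Idempotent idem_fst_subproof.
Definition idem_snd := Idempotent idem_snd_subproof.

(** * The element of F(S) attached to an idempotent of S *)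

Definition pull (F : functor (op Ring) Loc) (R S : pzRingType)
  (h : {rmorphism R -> S}) : frame_hom (F R) (F S) := @fmap _ _ F S R h.

Section IdemOpen.
Variable F : functor (op Ring) Loc.

Lemma pull_comp (R S T : pzRingType) (h : {rmorphism S -> T})
  (k : {rmorphism R -> S}) x : pull F (rcomp h k) x = pull F h (pull F k x).
Proof. by rewrite /pull (@fmap_comp _ _ F T S R). Qed.

Variable theta : forall A : comPzRingType, frame_hom (pierce_obj A) (F A).
Hypothesis theta_nat : forall (A B : comPzRingType) (h : {rmorphism A -> B}) I,
  pull F h (theta A I) = theta B (pierce_map h I).
Variable S : pzRingType.

(** The complement of p completes it to an orthogonal pair. An element that is not
idempotent gets the dummy value bottom, so that this is a plain function on S. *)
Definition idem_open (p : S) : F S :=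
  if pselect (p * p = p) is left pp
  then pull F (split_hom (orthoidem_compl pp)) (theta _ (principal idem_fst))
  else \bot.

(** The homomorphism from Z^3 attached to h e factors through the one attached to
e, so functoriality moves the computation to A, where naturality of theta
identifies the clopen. *)
Lemma idem_open_rmorphism (A : comPzRingType) (h : {rmorphism A -> S})
    (e : idempotents A) :
  idem_open (h (val e)) = pull F h (theta A (principal e)).
Proof.
have ee := idemM e.
rewrite /idem_open; case: pselect => [hee|[]]; last by rewrite -rmorphM ee.
have hpq : orthoidem (h (val e)) (h (1 - val e)).
  by rewrite rmorphB rmorph1; exact: orthoidem_compl.
have -> : split_hom (orthoidem_compl hee) =
    rcomp h (split_hom (orthoidem_compl ee)).
  (* The two sides differ only in the form of the second idempotent:
     1 - h e against h (1 - e). *)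
  rewrite (comp_split_hom _ hpq); apply: rmorphism_ext => z /=.
  by rewrite /split_map rmorphB rmorph1.
rewrite pull_comp [pull F (split_hom _) _]theta_nat pierce_map_principal.
congr (pull F h (theta A (principal _))); apply/val_inj => /=.
by rewrite /split_map /= mulr1z !mulr0z !addr0.
Qed.

(** Both idempotents come from the single commutative ring Z^3, in which they are
disjoint atoms, and every map on the way to F(S) preserves finite lattice
operations. *)
Lemma idem_open_orthoadditive : orthoadditive idem_open.
Proof.
move=> p q pq; pose h := split_hom pq.
have ep : idem_open p = pull F h (theta _ (principal idem_fst)).
  by rewrite -idem_open_rmorphism /= /split_map /= mulr1z !mulr0z !addr0.
have eq : idem_open q = pull F h (theta _ (principal idem_snd)).
  by rewrite -idem_open_rmorphism /= /split_map /= mulr1z !mulr0z addr0 add0r.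
split.
  rewrite ep eq -!frame_hom_meet -principal_meet.
  have -> : idem_fst `&` idem_snd = \bot by exact/val_inj.
  by rewrite principal_bot !frame_hom_bot.
rewrite ep eq -!frame_hom_join -principal_join -idem_open_rmorphism.
by rewrite /= /split_map /= !mulr1z !mulr0z addr0.
Qed.

Lemma idem_open1 : idem_open 1 = \top.
Proof.
pose h := split_hom (orthoidem_compl (mulr1 (1 : S))).
have h1 : 1 = h (val (\top : idempotents (int * int * int)%type)).
  by rewrite rmorph1.
rewrite [X in idem_open X]h1 idem_open_rmorphism principal_top.
by rewrite !frame_hom_top.
Qed.
End IdemOpen.

(** * Degenerate locales *)

Lemma degenerate_is_initial (L : Loc) :
  (\top : (L : locale)) = \bot -> is_initial L.
Proof.
move=> tb M.
have eqL (x y : (L : locale)) : x = y.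
  have bot z : z = \bot :> (L : locale) by apply/eqP; rewrite -lex0 -tb lex1.
  by rewrite (bot x) (bot y).
pose f : frame_hom M L :=
  @FrameHom M L (fun=> \top) (eqL _ _) (fun _ _ => eqL _ _) (fun=> eqL _ _).
by exists f; split=> // g _; apply: frame_hom_ext => x; exact: eqL.
Qed.

Lemma initial_isomorphic (C : category) (a b : C) :
  is_initial a -> is_initial b -> isomorphic a b.
Proof.
move=> ia ib; have [f _] := ia b; have [g _] := ib a.
have endo_uniq c (h k : Defs.hom c c) : is_initial c -> h = k.
  by move=> /(_ c)[u [_ uu]]; rewrite -(uu h) // -(uu k).
by exists f, g; split; exact: endo_uniq.
Qed.

Lemma empty_opens_degenerate :
  (\top : (opens empty_space : locale)) = \bot.
Proof. by apply/opens_inj/seteqP; split=> -[]. Qed.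

(** * A Kochen-Specker theorem for idempotent matrices *)

Section KochenSpecker.
Variables (K : comPzRingType) (n : nat) (L : locale) (v : 'M[K]_n -> L).
Hypothesis vP : orthoadditive v.
Implicit Types (x y : 'cV[K]_n) (f g : 'rV[K]_n) (c : L).

(** A triangle: vertices [x1], [x2], [x3], with [fi = 0] the side opposite to
[xi]. The vectors may live in a larger space than their span; the sum of the
products [xi *m fi] is then the projection onto that span, along the common
kernel of the [fi]. *)
Definition dual_triple x1 x2 x3 f1 f2 f3 : Prop :=
  [/\ [/\ f1 *m x1 = 1%:M, f1 *m x2 = 0 & f1 *m x3 = 0],
      [/\ f2 *m x1 = 0, f2 *m x2 = 1%:M & f2 *m x3 = 0] &
      [/\ f3 *m x1 = 0, f3 *m x2 = 0 & f3 *m x3 = 1%:M]].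

(* Proves an equation between the 1-by-1 matrices [f *m x], for linear
   combinations of the vectors and covectors of a triangle in context. *)
Local Ltac pairing :=
  rewrite ?(mulmxDl, mulmxDr, mulNmx, mulmxN);
  repeat match goal with H : _ *m _ = _ |- _ => rewrite ?H; clear H end;
  apply/matrixP => ? ?; rewrite !mxE; ring.

Local Ltac triple :=
  let H := fresh in
  move=> H; case: H => [[? ? ?] [? ? ?] [? ? ?]]; split; split; pairing.

Local Ltac sum_ring :=
  apply/matrixP => i j; rewrite !mxE !big_ord1 !mxE; ring.

Lemma rank1_orthoidem x f y g : f *m x = 1%:M -> g *m y = 1%:M ->
  f *m y = 0 -> g *m x = 0 -> orthoidem (x *m f) (y *m g).
Proof.
move=> fx gy fy gx; rewrite /orthoidem /GRing.mul /=.
have E (a b : 'cV[K]_n) (h k : 'rV[K]_n) :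
  a *m h *m (b *m k) = a *m (h *m b) *m k by rewrite !mulmxA.
by split; rewrite E ?fx ?gy ?fy ?gx ?mulmx1 ?mulmx0 ?mul0mx.
Qed.

Lemma rank1_meet x f y g : f *m x = 1%:M -> g *m y = 1%:M ->
  f *m y = 0 -> g *m x = 0 -> v (x *m f) `&` v (y *m g) = \bot.
Proof. by move=> fx gy fy gx; case: (vP (rank1_orthoidem fx gy fy gx)). Qed.

Lemma triple_join x1 x2 x3 f1 f2 f3 : dual_triple x1 x2 x3 f1 f2 f3 ->
  v (x1 *m f1 + x2 *m f2 + x3 *m f3) =
    v (x1 *m f1) `|` v (x2 *m f2) `|` v (x3 *m f3).
Proof.
case=> [[a11 a12 a13] [a21 a22 a23] [a31 a32 a33]].
have o12 := rank1_orthoidem a11 a22 a12 a21.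
have [p11 p22 p12 p21] := o12.
have [_ p33 p13 p31] := rank1_orthoidem a11 a33 a13 a31.
have [_ _ p23 p32] := rank1_orthoidem a22 a33 a23 a32.
have o3 : orthoidem (x1 *m f1 + x2 *m f2) (x3 *m f3).
  split => //.
  - by rewrite mulrDr !mulrDl p11 p22 p12 p21 addr0 add0r.
  - by rewrite mulrDl p13 p23 addr0.
  - by rewrite mulrDr p31 p32 addr0.
by rewrite (vP o3).2 (vP o12).2.
Qed.

(** The case analysis on a triangle, at the stage [c] of the internal logic: some
vertex is true, hence the third one is if [c] refutes the other two. *)
Lemma third_of_triple c e x1 x2 x3 f1 f2 f3 : dual_triple x1 x2 x3 f1 f2 f3 ->
  c <= v e -> x1 *m f1 + x2 *m f2 + x3 *m f3 = e ->
  c `&` v (x1 *m f1) = \bot -> c `&` v (x2 *m f2) = \bot ->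
  c <= v (x3 *m f3).
Proof.
move=> tr + ce; rewrite -ce (triple_join tr) => /meet_idPl cv c1 c2.
by rewrite -cv !frame_meetUr c1 c2 joinxx joinC joinx0 leIr.
Qed.

Lemma disjointS c (a b : L) : c <= a -> a `&` b = \bot -> c `&` b = \bot.
Proof. by move=> ca ab; apply/eqP; rewrite -lex0 -ab leI2. Qed.

Lemma le_triple_sum x1 x2 x3 f1 f2 f3 : dual_triple x1 x2 x3 f1 f2 f3 ->
  v (x1 *m f1) <= v (x1 *m f1 + x2 *m f2 + x3 *m f3).
Proof. by move=> tr; rewrite (triple_join tr) -joinA leUl. Qed.

(** Let a = [x1], b = [x2], with lines L : [f1 = 0] and M : [f1 + f2 = 0]; so b
is on L while a is off M. Suppose (a, L) and (b, M) both true. For a point e of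
L, let d be the intersection of M with the line through a and e, and let e' be
another point of L. In the triangle e, e', d the vertex e' is excluded by (a, L)
because its opposite side passes through a, and the vertex d is excluded by
(b, M) because its opposite side is L. So (e, e'd) is true. Exchanging e and e'
gives a true (e', ed') with d' on M, and these two are orthogonal. The choice
e = [x2], e' = [x2 + x3] makes d = [x1 - x2] and d' = [x1 - x2 - x3] (up to
sign), and all the triangles are unimodular over any ring. *)
Lemma sheared_meet x1 x2 x3 f1 f2 f3 : dual_triple x1 x2 x3 f1 f2 f3 ->
  v (x1 *m f1) `&` v (x2 *m (f1 + f2)) = \bot.
Proof.
move=> tr; have [[a11 a12 a13] [a21 a22 a23] [a31 a32 a33]] := tr.
set c := _ `&` _.
have c1 : c <= v (x1 *m f1) by exact: leIl.
have c2 : c <= v (x2 *m (f1 + f2)) by exact: leIr.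
have cv := le_trans c1 (le_triple_sum tr).
have t1 : c <= v (x2 *m (f1 + f2 - f3)).
  apply: (@third_of_triple c _ (x2 + x3) (x1 - x2) x2 f3 f1 (f1 + f2 - f3)).
  - by move: tr; triple.
  - exact: cv.
  - by sum_ring.
  - by apply: disjointS c1 _; apply: rank1_meet; pairing.
  - by apply: disjointS c2 _; apply: rank1_meet; pairing.
have t2 : c <= v ((x2 + x3) *m (f1 + f3)).
  apply: (@third_of_triple c _ x2 (x1 - x2 - x3) (x2 + x3)
    (f2 - f3) f1 (f1 + f3)).
  - by move: tr; triple.
  - exact: cv.
  - by sum_ring.
  - by apply: disjointS c1 _; apply: rank1_meet; pairing.
  - by apply: disjointS c2 _; apply: rank1_meet; pairing.
apply/eqP; rewrite -lex0.
suff <- : v (x2 *m (f1 + f2 - f3)) `&` v ((x2 + x3) *m (f1 + f3)) = \bot.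
  by rewrite lexI t1.
by apply: rank1_meet; pairing.
Qed.

(** The triangle [x1 - x2], [x2], [x3] has [f1 = 0] as the side opposite to its
first vertex. Its vertex [x3] is orthogonal to ([x1], [f1]) and its vertex [x2]
has opposite side [f1 + f2 = 0], as in the previous lemma. *)
Lemma point_shift x1 x2 x3 f1 f2 f3 : dual_triple x1 x2 x3 f1 f2 f3 ->
  v (x1 *m f1) <= v ((x1 - x2) *m f1).
Proof.
move=> tr; have [[a11 a12 a13] [a21 a22 a23] [a31 a32 a33]] := tr.
apply: (@third_of_triple _ _ x3 x2 (x1 - x2) f3 (f1 + f2) f1).
- by move: tr; triple.
- exact: le_triple_sum tr.
- by sum_ring.
- exact: rank1_meet.
- exact: sheared_meet tr.
Qed.

(** The line M : [f1 + f2 = 0] passes through the vertex [x3] and excludes the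
three vertices of the triangle: [x1] and [x2] by [sheared_meet], after moving
the point off M from [x2] to [x1] in the second case, and [x3] by
orthogonality. *)
Lemma sheared_bot x1 x2 x3 f1 f2 f3 : dual_triple x1 x2 x3 f1 f2 f3 ->
  v (x2 *m (f1 + f2)) = \bot.
Proof.
move=> tr; have [[a11 a12 a13] [a21 a22 a23] [a31 a32 a33]] := tr.
set c := v _.
have cshift : c <= v (x1 *m (f1 + f2)).
  (* This is the shift of the point in the triangle [x2], [x2 - x1], [x3]. *)
  have -> : x1 = x2 - (x2 - x1) by rewrite opprB addrC subrK.
  apply: (@point_shift _ _ x3 _ (- f1) f3).
  by move: tr; triple.
have c3 : c <= v (x3 *m f3).
  apply: (@third_of_triple c _ x1 x2 x3 f1 f2 f3 tr _ erefl).
  - have tr' : dual_triple x2 (x1 - x2) x3 (f1 + f2) f1 f3.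
      by move: tr; triple.
    have -> : x1 *m f1 + x2 *m f2 + x3 *m f3 =
        x2 *m (f1 + f2) + (x1 - x2) *m f1 + x3 *m f3 by sum_ring.
    exact: le_triple_sum tr'.
  - by rewrite meetC; exact: sheared_meet tr.
  - apply: disjointS cshift _; rewrite meetC addrC.
    by apply: (@sheared_meet _ _ x3 _ _ f3); move: tr; triple.
rewrite -[c]meetxx; apply: (disjointS c3); rewrite meetC.
by apply: rank1_meet; pairing.
Qed.

(** Any side is such a line M, for the triangle obtained from the given one by
moving a vertex: [f1 = - f2 + (f1 + f2)]. *)
Lemma rank1_bot x1 x2 x3 f1 f2 f3 : dual_triple x1 x2 x3 f1 f2 f3 ->
  v (x1 *m f1) = \bot.
Proof.
move=> tr; have -> : f1 = - f2 + (f1 + f2) by rewrite addrC addrK.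
by apply: (@sheared_bot (x1 - x2) _ x3 _ _ f3); move: tr; triple.
Qed.

(** The condition n >= 3 lets every diagonal matrix unit be a vertex of a
triangle of matrix units. *)
Lemma orthoadditive_bot : (3 <= n)%N -> v 1 = \bot.
Proof.
move=> n3.
have diag_bot (i : 'I_n) : v (delta_mx i i) = \bot.
  have /card_gt0P[j] : (0 < #|~: [set i]|)%N.
    by rewrite cardsCs finset.setCK cards1 card_ord subn_gt0 (leq_trans _ n3).
  rewrite !inE => ij.
  have /card_gt0P[k] : (0 < #|~: [set i; j]|)%N.
    rewrite cardsCs finset.setCK card_ord subn_gt0 (leq_trans _ n3) //.
    by rewrite cards2; case: (i != j).
  rewrite !inE negb_or => /andP[ik jk].
  rewrite -(mul_delta_mx (ord0 : 'I_1)).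
  apply: (@rank1_bot _ (delta_mx j ord0) (delta_mx k ord0)
    _ (delta_mx ord0 j) (delta_mx ord0 k)).
  have E (a : 'I_n) :
      delta_mx (ord0 : 'I_1) a *m delta_mx a (ord0 : 'I_1) = 1%:M :> 'M[K]_1.
    by rewrite mul_delta_mx; apply/matrixP => s t; rewrite !mxE !ord1.
  by split; split; rewrite ?E // mul_delta_mx_0 // eq_sym.
have vsum (s : seq 'I_n) : uniq s -> v (\sum_(i <- s) delta_mx i i) = \bot.
  elim: s => [_|i s IHs /= /andP[is_ us]].
    rewrite big_nil -[RHS](vP (p := 0) (q := 0) _).1 ?meetxx //.
    by split; rewrite mulr0.
  rewrite big_cons (vP _).2 ?diag_bot ?IHs ?joinxx //.
  have idem (j : 'I_n) : delta_mx j j * delta_mx j j = delta_mx j j :> 'M[K]_n.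
    exact: mul_delta_mx.
  have orth (j k : 'I_n) : j != k -> delta_mx j j * delta_mx k k = 0 :> 'M[K]_n.
    exact: mul_delta_mx_0.
  have is0 j : j \in s -> i != j by apply: contraTneq => <-.
  split=> //.
  - rewrite mulr_suml; apply: eq_big_seq => j js.
    rewrite mulr_sumr (bigD1_seq j) //= idem big1 ?addr0 // => k kj.
    by rewrite orth // eq_sym.
  - by rewrite mulr_sumr big_seq big1 // => j /is0; exact: orth.
  - by rewrite mulr_suml big_seq big1 // => j /is0; rewrite eq_sym; exact: orth.
have -> : 1 = \sum_(i <- index_enum 'I_n) delta_mx i i :> 'M[K]_n.
  apply/matrixP => i j; rewrite summxE [LHS]mxE (bigD1 i) //= !mxE eqxx /= big1.
    by rewrite addr0 eq_sym.
  by move=> k ki; rewrite !mxE eq_sym (negPf ki).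
exact: vsum (index_enum_uniq _).
Qed.
End KochenSpecker.

Theorem corollary7p3 (R : realType) (n : nat) (n_ge3 : (3 <= n)%N)
  (F : functor (op Ring) Loc)
  (F_Pierce : nat_isomorphic (comp_functor F (op_functor cRing_incl)) Pierce) :
  is_initial (F ('M[R[i]]_n : pzRingType)) /\
  isomorphic (F ('M[R[i]]_n : pzRingType)) (opens empty_space : locale).
Proof.
have [theta [_ theta_nat]] := F_Pierce.
have theta_natural (A B : comPzRingType) (h : {rmorphism A -> B}) I :
    pull F h (theta A I) = theta B (pierce_map h I).
  have /(congr1 (fun k : frame_hom (pierce_obj A) (F B) => k I)) :=
    theta_nat B A h.
  by [].
pose v := @idem_open F theta 'M[R[i]]_n.
have v_ortho : orthoadditive v.
  exact: idem_open_orthoadditive theta_natural _.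
have initial_F : is_initial (F ('M[R[i]]_n : pzRingType)).
  apply: degenerate_is_initial.
  by rewrite -(orthoadditive_bot v_ortho n_ge3) /v (idem_open1 theta_natural).
split=> //; apply: initial_isomorphic => //.
exact: degenerate_is_initial empty_opens_degenerate.
Qed.
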